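(* For every integer $k\ge1$ there is a constant $C_k>0$, depending only on $k$, such that for every power $q$ of an odd prime, every $E\subseteq\mathbb F_q^2$, and every $\alpha=(\alpha_1,\dots,\alpha_k)\in\mathbb F_q^k$ with all components nonzero, $$|\Pi_\alpha(E)|\le C_k\,|E|^{\left\lceil \frac{2(k+1)}{3}\right\rceil}.$$
   Context: $\mathbb F_q$ is the finite field with $q$ elements, and $x\cdot y=x_1y_1+x_2y_2\in\mathbb F_q$ for $x=(x_1,x_2)$, $y=(y_1,y_2)$ in $\mathbb F_q^2$. For a sequence $\alpha=(\alpha_1,\dots,\alpha_k)$ of elements of $\mathbb F_q$, a dot product $k$-chain (of type $\alpha$) is a $(k+1)$-tuple of distinct points $(x_1,\dots,x_{k+1})$ with $x_j\cdot x_{j+1}=\alpha_j$ for every $1\le j\le k$. For $E\subseteq\mathbb F_q^2$, $\Pi_\alpha(E)$ is the set of dot product $k$-chains of type $\alpha$ all of whose points lie in $E$. Throughout, $k$ is treated as a constant. *)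

(* Defs.v *)
From HB Require Import structures.
From mathcomp Require Import all_boot all_order all_algebra.

Set Implicit Arguments.
Unset Strict Implicit.
Unset Printing Implicit Defensive.

Import Order.TTheory GRing.Theory Num.Theory.
Local Open Scope ring_scope.

Definition dotp (F : finFieldType) (x y : 'rV[F]_2) : F :=
  x 0 0 * y 0 0 + x 0 1 * y 0 1.

(* Indices are 0-based: for j : 'I_k, [widen_ord (leqnSn k) j] and
   [lift ord0 j] are the positions j and j + 1 of the (k + 1)-tuple. *)
Definition dot_chain (F : finFieldType) (k : nat) (alpha : k.-tuple F)
    (x : k.+1.-tuple 'rV[F]_2) : bool :=
  uniq x &&
  [forall j : 'I_k,
     dotp (tnth x (widen_ord (leqnSn k) j)) (tnth x (lift ord0 j))
       == tnth alpha j].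

Definition dot_chains (F : finFieldType) (k : nat) (alpha : k.-tuple F)
    (E : {set 'rV[F]_2}) : {set k.+1.-tuple 'rV[F]_2} :=
  [set x : k.+1.-tuple 'rV[F]_2 | dot_chain alpha x & all (fun p => p \in E) x].

(* Main.v *)
(* Cut the chain into consecutive triples. For given nonzero [a] and [b] there
    are at most [2 |E|^2] triples [(x, y, z)] in [E^3] with [x.y = a] and
    [y.z = b]: the points [y] with [x.y = a] form a line, as do those with
    [y.z = b], so either [(x, z)] determines [y] or the two lines coincide, in
    which case [z = (b / a) x]. The at most two points left over contribute a
    factor [|E|] each. *)

Require Import Defs.
From mathcomp Require Import all_boot all_order all_algebra.
From mathcomp Require Import zify ring lra.

Set Implicit Arguments.
Unset Strict Implicit.
Unset Printing Implicit Defensive.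

Import Order.TTheory GRing.Theory Num.Theory.
Local Open Scope ring_scope.

Lemma row2P (R : Type) (u v : 'rV[R]_2) : u 0 0 = v 0 0 -> u 0 1 = v 0 1 -> u = v.
Proof.
move=> e0 e1; apply/rowP => -[[|[|//]] i2].
  by rewrite (_ : Ordinal i2 = 0) //; apply: val_inj.
by rewrite (_ : Ordinal i2 = 1) //; apply: val_inj.
Qed.

(** By contraposition: if [y] and [y'] differ, Cramer's rule forces the determinant of [x] and [z]
    to vanish, and then [a *: z = b *: x]. *)
Lemma dotp_lines_inj (F : finFieldType) (a b : F) (x y y' z : 'rV[F]_2) :
  a != 0 -> dotp x y = a -> dotp y z = b -> dotp x y' = a -> dotp y' z = b ->
  z != (b / a) *: x -> y = y'.
Proof.
rewrite /dotp => a0 xy yz xy' y'z zx; apply/eqP; apply: contraNT zx => yy'.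
pose D := x 0 0 * z 0 1 - x 0 1 * z 0 0.
have D0 : D = 0.
  apply/eqP; apply: contraNT yy' => D0.
  have E0 : D * (y 0 0 - y' 0 0) = z 0 1 * (a - a) - x 0 1 * (b - b).
    by rewrite -{1}xy -xy' -{1}yz -y'z /D; ring.
  have E1 : D * (y 0 1 - y' 0 1) = x 0 0 * (b - b) - z 0 0 * (a - a).
    by rewrite -{1}xy -xy' -{1}yz -y'z /D; ring.
  rewrite !subrr !mulr0 subrr in E0 E1.
  by apply/eqP/row2P; apply/eqP; rewrite -subr_eq0 -(mulrI_eq0 _ (mulfI D0)) ?E0 ?E1.
(* The coordinates of [a *: z - b *: x] are [- y 0 1 * D] and [y 0 0 * D]. *)
have H0 : a * z 0 0 = b * x 0 0.
  by apply/eqP; rewrite -subr_eq0 -(mulr0 (- y 0 1)) -D0 -xy -yz /D; apply/eqP; ring.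
have H1 : a * z 0 1 = b * x 0 1.
  by apply/eqP; rewrite -subr_eq0 -(mulr0 (y 0 0)) -D0 -xy -yz /D; apply/eqP; ring.
by apply/eqP/row2P; apply: (mulfI a0); rewrite mxE mulrA mulrCA divff // mulr1.
Qed.

Definition dot_triples (F : finFieldType) (E : {set 'rV[F]_2}) (a b : F) :=
  [set t : 'rV[F]_2 * 'rV[F]_2 * 'rV[F]_2 |
    [&& t.1.1 \in E, t.1.2 \in E & t.2 \in E] &&
    ((dotp t.1.1 t.1.2 == a) && (dotp t.1.2 t.2 == b))].

Lemma card_dot_triples (F : finFieldType) (E : {set 'rV[F]_2}) (a b : F) :
  a != 0 -> (#|dot_triples E a b| <= 2 * #|E| ^ 2)%N.
Proof.
move=> a0; pose D :=
  [set t : 'rV[F]_2 * 'rV[F]_2 * 'rV[F]_2 | t.2 == (b / a) *: t.1.1].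
have cE : #|setX E E| = (#|E| ^ 2)%N by rewrite cardsX.
(* Inside [D] the pair [(x, y)] determines the triple; outside [D] the pair [(x, z)] does. *)
rewrite mul2n -addnn -(cardsID D) leq_add // -cE.
  rewrite -(@card_in_imset _ _ (fun t => t.1)).
    apply/subset_leq_card/subsetP => u /imsetP[[[x y] z]].
    by rewrite !inE /= => /andP[/andP[/and3P[xE yE _] _] _] ->; rewrite /= xE.
  move=> [[x y] z] [[x' y'] z']; rewrite !inE /=.
  by move=> /andP[_ /eqP->] /andP[_ /eqP->] [-> ->].
rewrite -(@card_in_imset _ _ (fun t => (t.1.1, t.2))).
  apply/subset_leq_card/subsetP => u /imsetP[[[x y] z]].
  by rewrite !inE /= => /andP[_ /andP[/and3P[xE _ zE] _]] ->; rewrite /= xE.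
move=> [[x y] z] [[x' y'] z']; rewrite !inE /=.
move=> /andP[zx /andP[_ /andP[/eqP xy /eqP yz]]].
move=> /andP[_ /andP[_ /andP[/eqP xy' /eqP yz']]] [xx zz]; subst x' z'.
by rewrite (dotp_lines_inj a0 xy yz xy' yz' zx).
Qed.

(** With plain sequences and a total [al], the tail of a walk is again a walk, for a shifted
    [al]. *)
Definition dot_walk (F : finFieldType) (al : nat -> F) (x : seq 'rV[F]_2) :=
  forall j, (j.+1 < size x)%N -> dotp (nth 0 x j) (nth 0 x j.+1) = al j.

(** Here [m] counts points, and the exponent is the ceiling of [2 * m / 3]. Passing from [m] to
    [m + 3] prepends a triple and raises the exponent by exactly 2. *)
Lemma dot_walks_cover (F : finFieldType) (E : {set 'rV[F]_2}) m (al : nat -> F) :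
  (forall j, al j != 0) ->
  exists2 W : seq (seq 'rV[F]_2),
    (size W <= 2 ^ m * #|E| ^ ((2 * m + 2) %/ 3))%N &
    forall x, size x = m -> dot_walk al x -> {subset x <= E} -> x \in W.
Proof.
elim/ltn_ind: m al => -[|[|[|m]]] IH al al0.
- by exists [:: [::]] => // -[].
- exists [seq [:: p] | p <- enum E] => [|[|p []] // _ _ xE].
    by rewrite size_map -cardE expn1 leq_pmull.
  by apply/map_f; rewrite mem_enum xE ?mem_head.
- exists [seq [:: p; p'] | p <- enum E, p' <- enum E].
    by rewrite size_allpairs -cardE mulnn leq_pmull.
  move=> [|p [|p' []]] // _ _ xE; apply: (allpairs_f (fun u v => [:: u; v]));
    by rewrite mem_enum xE // !inE eqxx ?orbT.
have lt_m : (m < m.+3)%N by lia.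
(* The triple uses [al 0] and [al 1]; the cover does not impose the relation [al 2] between the
   triple and the rest. *)
have [W sW xW] := IH m lt_m (fun j => al j.+3) (fun j => al0 j.+3).
exists [seq [:: t.1.1, t.1.2, t.2 & w] |
          t <- enum (dot_triples E (al 0%N) (al 1%N)), w <- W].
  rewrite size_allpairs -cardE.
  have -> : ((2 * m.+3 + 2) %/ 3 = 2 + (2 * m + 2) %/ 3)%N by lia.
  apply: leq_trans (leq_mul (card_dot_triples E _ (al0 0%N)) sW) _.
  by rewrite mulnACA -expnD -expnS leq_mul2r leq_pexp2l ?orbT //; lia.
move=> [|x [|y [|z s]]] // [ss] ws xE.
pose cat3 (t : 'rV[F]_2 * 'rV[F]_2 * 'rV[F]_2) w := [:: t.1.1, t.1.2, t.2 & w].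
apply: (allpairs_f cat3 (x := (x, y, z))).
  rewrite mem_enum inE /= !xE ?inE ?eqxx ?orbT //=.
  by rewrite (ws 0%N) // (ws 1%N) // !eqxx.
apply: xW => // [j js|p ps]; first exact: (ws j.+3).
by apply: xE; rewrite !inE ps !orbT.
Qed.

(** Matches the exponent of the theorem with that of the cover. *)
Lemma ceil_div3 n : `|Num.ceil (n%:R / 3%:R : rat)|%N = ((n + 2) %/ 3)%N.
Proof.
rewrite (@ceil_def _ _ ((n + 2) %/ 3)%N) // rmorphB /=.
have h1 : (n <= (n + 2) %/ 3 * 3)%N by lia.
have h2 : ((n + 2) %/ 3 * 3 < n + 3)%N by lia.
move: h1 h2; rewrite -(ler_nat rat) -(ltr_nat rat) natrM natrD.
by move=> h1 h2; apply/andP; split; lra.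
Qed.

Theorem theorem1p5 (k : nat) (hk : (1 <= k)%N) :
  exists2 C : nat, (0 < C)%N &
    forall (p n : nat) (hp : prime p) (hodd : odd p) (hn : (0 < n)%N)
      (F : finFieldType) (hF : #|F| = (p ^ n)%N)
      (E : {set 'rV[F]_2}) (alpha : k.-tuple F)
      (halpha : forall j : 'I_k, tnth alpha j != 0),
    (#|dot_chains alpha E|
       <= C * #|E| ^ `|Num.ceil ((2 * (k + 1))%:R / 3%:R : rat)|)%N.
Proof.
exists (2 ^ k.+1)%N; first by rewrite expn_gt0.
move=> p n _ _ _ F _ E alpha halpha.
(* The default value 1 keeps the extended sequence nonzero beyond index [k]. *)
have al0 j : nth 1 alpha j != 0.
  have [jk|kj] := ltnP j k; last by rewrite nth_default ?size_tuple ?oner_neq0.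
  by have := halpha (Ordinal jk); rewrite (tnth_nth 1).
have [W sW xW] := dot_walks_cover E k.+1 al0.
rewrite ceil_div3 addn1; apply: leq_trans sW.
(* The chains, read as sequences, are pairwise distinct members of [W]. *)
rewrite cardE -(size_map val); apply: uniq_leq_size.
  by rewrite map_inj_uniq ?enum_uniq //; exact: val_inj.
move=> _ /mapP[x + ->]; rewrite mem_enum inE.
move=> /andP[/andP[_ /forallP xw] /allP xE]; apply: xW => //; first exact: size_tuple.
move=> j; rewrite size_tuple ltnS => jk.
by have /eqP := xw (Ordinal jk); rewrite (tnth_nth 1 alpha) !(tnth_nth 0).
Qed.
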